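(* Let $Z$ be a real random variable with probability density $p_Z$ (with respect to Lebesgue measure on $\mathbb{R}$) such that $p_Z(z)>0$ for every $z\in\mathbb{R}$ and such that the function $F(z):=-\log p_Z(z)$ is continuous on $\mathbb{R}$. Consider the additive noise model $Y=X+Z$ where $X\in\mathbb{R}$ and $Z$ are independent, so that the conditional density of $Y$ given $x\in\mathbb{R}$ is $p_{Y|X}(y|x)=p_Z(y-x)$. The following properties are equivalent: (a) the function $F$ is convex (i.e., the noise distribution is log-concave); (b) for any prior probability distribution $p_X$ on the random variable $X\in\mathbb{R}$, the conditional expectation $\mathbb{E}(X|Y=y)$ is well defined for any $y\in\mathbb{R}$, and there is a (possibly nonconvex) proper penalty function $\tilde\varphi_X:\mathbb{R}\to\mathbb{R}\cup\{+\infty\}$, depending on $p_X$ and $F$, such that for any $y\in\mathbb{R}$ $$\mathbb{E}(X|Y=y)\in\arg\min_{x\in\mathbb{R}}\left\{\tfrac12(y-x)^2+\tilde\varphi_X(x)\right\}.$$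
   Context: A prior $p_X$ is an arbitrary probability distribution on $\mathbb{R}$ (not necessarily having a density; e.g. finite combinations of Dirac masses are allowed). The conditional expectation is understood pointwise through the formula $$\mathbb{E}(X|Y=y)=\frac{\mathbb{E}_X\left(X\,p_Z(y-X)\right)}{\mathbb{E}_X\left(p_Z(y-X)\right)},$$ and it is well defined at $y$ when $\mathbb{E}_X\left((1+|X|)\,p_Z(y-X)\right)<\infty$. A function with values in $\mathbb{R}\cup\{+\infty\}$ is proper if it is not identically $+\infty$. *)

(* Defs.v *)
From HB Require Import structures.
From mathcomp Require Import all_boot all_order all_algebra.
From mathcomp Require Import all_classical all_reals all_analysis.

Set Implicit Arguments.
Unset Strict Implicit.
Unset Printing Implicit Defensive.
Import Order.TTheory GRing.Theory Num.Theory.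
Import numFieldNormedType.Exports.
Local Open Scope classical_set_scope.
Local Open Scope ring_scope.

Definition density_of (R : realType) (d : measure_display)
    (Omega : measurableType d) (P : probability Omega R) (Z : {RV P >-> R})
    (p : R -> R) : Prop :=
  [/\ measurable_fun setT p, forall z, 0 <= p z &
      forall A : set R, measurable A ->
        distribution P Z A = (\int[lebesgue_measure]_(z in A) (p z)%:E)%E].

(* For Y = X + Z with X and Z independent, Z of density pZ: the density at y of
   the law of Y given X = x, i.e. of the law of x + Z. *)
Definition density_Y_given_X (R : realType) (pZ : R -> R) (y x : R) : R :=
  pZ (y - x).

Definition cond_expectation_well_defined (R : realType) (pZ : R -> R)
    (pX : probability (measurableTypeR R) R) (y : R) : Prop :=
  ('E_pX[(fun x : R => (1 + `|x|) * density_Y_given_X pZ y x)%R] < +oo)%E.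

(* E(X | Y = y) by Bayes' formula; [fine] is harmless as soon as
   [cond_expectation_well_defined] holds, both expectations being then finite. *)
Definition cond_expectation (R : realType) (pZ : R -> R)
    (pX : probability (measurableTypeR R) R) (y : R) : R :=
  fine 'E_pX[(fun x : R => x * density_Y_given_X pZ y x)%R]%E /
  fine 'E_pX[density_Y_given_X pZ y]%E.

(* Functions R -> R u {+oo} are functions R -> \bar R that avoid -oo. *)
Definition proper_penalty (R : realType) (phi : R -> \bar R) : Prop :=
  (forall x, phi x != -oo%E) /\ (exists x, phi x != +oo%E).

Definition argmin (R : realType) (g : R -> \bar R) : set R :=
  [set x | forall x', (g x <= g x')%E].

(* Main.v *)
(* A map f is a selection of prox_phi for some proper phi iff f is nondecreasing:
   if f is monotone, psi = int_0 f satisfies psi y + f y (z - y) <= psi z, and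
   phi x = psi^* x - x^2/2 works. If p = exp (-F) is log-concave, then for y < z
   the ratio p(z - x) / p(y - x) is nondecreasing in x, so the posterior mean is
   nondecreasing; it is well defined since a quasiconcave integrable p satisfies
   |z| p z = O(1). Conversely, monotonicity of the posterior mean for the prior
   (delta_0 + delta_h)/2 between x and x + h reads p(x-h) p(x+h) <= (p x)^2,
   i.e. midpoint convexity of F, which is convexity by continuity. *)
Require Import Defs.
From HB Require Import structures.
From mathcomp Require Import all_boot all_order all_algebra.
From mathcomp Require Import all_classical all_reals all_analysis.
From mathcomp Require Import measurable_realfun ring lra.
Import Order.TTheory GRing.Theory Num.Theory.
Import numFieldNormedType.Exports.
Local Open Scope classical_set_scope.
Local Open Scope ring_scope.

(** * Inequalities for convex functions of one variable *)

Lemma midpoint_convex_continuous (R : realType) (f : R -> R) :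
  continuous f ->
  (forall x h, f x *+ 2 <= f (x - h) + f (x + h)) ->
  forall a b t, 0 <= t <= 1 ->
    f (t * a + (1 - t) * b) <= t * f a + (1 - t) * f b.
Proof.
move=> cf mid a b t t01; apply/ler_addgt0Pr => e e0.
(* The term [e * (s * (s - 1))] makes [g] strictly midpoint convex, so that its
   maximum over [0, 1] is reached at an endpoint, where [g] vanishes. *)
pose g (s : R) :=
  f (s * a + (1 - s) * b) - (s * f a + (1 - s) * f b) + e * (s * (s - 1)).
have cg : continuous g.
  have caff k l : continuous (fun s : R => s * k + l).
    move=> s; apply: cvgD; last exact: cvg_cst.
    by apply: cvgM; [exact: cvg_id|exact: cvg_cst].
  have -> : g = (fun s => f (s * (a - b) + b) - (s * (f a - f b) + f b)
                        + e * (s * (s * 1 + - 1))).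
    by apply/funext => s; rewrite /g; congr (f _ - _ + _); ring.
  move=> s; apply: cvgD; first apply: cvgB.
  - exact: (continuous_comp (caff _ _ s) (cf _)).
  - exact: caff.
  - apply: cvgM; first exact: cvg_cst.
    by apply: cvgM; [exact: cvg_id|exact: caff].
(* The chord is affine and contributes nothing; the second difference of [e * (s * (s - 1))] is
   [2 * e * h ^+ 2]. *)
have midg s h : g s *+ 2 + e * h ^+ 2 *+ 2 <= g (s - h) + g (s + h).
  have := mid (s * a + (1 - s) * b) (h * (a - b)).
  rewrite (_ : _ - h * (a - b) = (s - h) * a + (1 - (s - h)) * b); last by ring.
  rewrite (_ : _ + h * (a - b) = (s + h) * a + (1 - (s + h)) * b); last by ring.
  rewrite /g; lra.
have [c] := EVT_max ler01 (continuous_subspaceT cg).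
rewrite in_itv/= => /andP[c0 c1] gmax.
have gc0 : g c <= 0.
  have g0 : g 0 = 0.
    by rewrite /g !mul0r subr0 !mul1r !add0r mulr0; ring.
  have g1 : g 1 = 0.
    by rewrite /g !mul1r subrr !mul0r !addr0 mulr0; ring.
  have [->|cn0] := eqVneq c 0; first by rewrite g0.
  have [->|cn1] := eqVneq c 1; first by rewrite g1.
  have cp0 : 0 < c by rewrite lt_def cn0.
  have cp1 : c < 1 by rewrite lt_def eq_sym cn1.
  (* With this [h], both [c - h] and [c + h] stay in [0, 1], where [g] is at most [g c]. *)
  exfalso; pose h := Num.min c (1 - c).
  have h0 : 0 < h by rewrite lt_min cp0 subr_gt0.
  have hc : h <= c by rewrite ge_min lexx.
  have hc1 : h <= 1 - c by rewrite ge_min lexx orbT.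
  have e1 : g (c - h) <= g c.
    by apply: gmax; rewrite in_itv/=; apply/andP; split; lra.
  have e2 : g (c + h) <= g c.
    by apply: gmax; rewrite in_itv/=; apply/andP; split; lra.
  have := midg c h; have : 0 < e * h ^+ 2 by rewrite mulr_gt0// exprn_gt0.
  lra.
have gt : g t <= 0 by apply: le_trans gc0; apply: gmax; rewrite in_itv.
have : e * (t * (1 - t)) <= e.
  case/andP: t01 => t0 t1; rewrite ger_pMr//; nra.
move: gt; rewrite /g; lra.
Qed.

(** With [s = t * (b - a)], the inner points are convex combinations of [a] and [b] with swapped
    weights; the two convexity inequalities are added. *)
Lemma convex_shift_in (R : realFieldType) (f : R -> R) :
  (forall a b t, 0 <= t <= 1 ->
     f (t * a + (1 - t) * b) <= t * f a + (1 - t) * f b) ->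
  forall a b s, 0 <= s <= b - a -> f (a + s) + f (b - s) <= f a + f b.
Proof.
move=> cf a b s /andP[s0 sab].
have [ab|ab] := eqVneq a b.
  have s00 : s = 0 by lra.
  by rewrite s00 addr0 subr0.
have ba0 : 0 < b - a by rewrite lt_def subr_eq0 eq_sym ab; lra.
pose t := s / (b - a).
have t01 : 0 <= t <= 1.
  by rewrite /t ler_pdivrMr// mul1r sab (divr_ge0 s0 (ltW ba0)).
have st : s = t * (b - a) by rewrite /t divfK ?gt_eqF.
have t01' : 0 <= 1 - t <= 1 by lra.
have := cf a b _ t01; have := cf a b _ t01'.
rewrite (_ : (1 - t) * a + _ = a + s); last by rewrite st; ring.
rewrite (_ : t * a + _ = b - s); last by rewrite st; ring.
lra.
Qed.

(** * Proximal maps and monotone functions *)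

(** Testing the minimality of [f y1] against [f y2] and conversely, then adding, cancels [phi] and
    leaves [0 <= (y2 - y1) * (f y2 - f y1)]. *)
Lemma argmin_prox_nondecreasing (R : realType) (phi : R -> \bar R)
    (f : R -> R) :
  proper_penalty phi ->
  (forall y, argmin (fun x => ((2^-1 * (y - x) ^+ 2)%:E + phi x)%E) (f y)) ->
  nondecreasing_fun f.
Proof.
move=> [phiNy [x0 phix0]] fmin y1 y2; rewrite le_eqVlt => /predU1P[->//|y12].
(* The cancellation needs finite penalties: a minimizer with infinite penalty would be beaten by
   [x0]. *)
have phif y : phi (f y) \is a fin_num.
  rewrite fin_numE phiNy/=; apply/eqP => phiy.
  have := fmin y x0; rewrite phiy addey// leye_eq.
  by move: (phiNy x0) phix0; case: (phi x0).
have := fmin y1 (f y2); have := fmin y2 (f y1).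
rewrite -(fineK (phif y1)) -(fineK (phif y2)) -!EFinD !lee_fin.
set p1 := fine _; set p2 := fine _ => h2 h1.
have : 0 <= (y2 - y1) * (f y2 - f y1) by lra.
by rewrite pmulr_rge0 ?subr_gt0// subr_ge0.
Qed.

Lemma nondecreasing_integrable_itv (R : realType) (f : R -> R) a b :
  nondecreasing_fun f ->
  (@lebesgue_measure R).-integrable `]a, b] (EFin \o f).
Proof.
move=> ndf; apply: measurable_bounded_integrable => //.
- rewrite [ltLHS](@lebesgue_measure_itv R `]a, b])/=.
  by case: ifPn => // _; rewrite -EFinB ltry.
- exact: nondecreasing_measurable.
exists (Num.max `|f a| `|f b|); split; first exact: num_real.
move=> M /ltW; rewrite ge_max => /andP[Ma Mb] x /=.
rewrite in_itv/= => /andP[/ltW/ndf ax /ndf xb].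
move: Ma Mb; rewrite !ler_norml; lra.
Qed.

(** For [psi] a primitive of [f], monotonicity bounds its increment from [y] to [z] below by
    [f y * (z - y)], on either side of [y]. *)
Lemma nondecreasing_subgradient (R : realType) (f : R -> R) :
  nondecreasing_fun f ->
  exists psi : R -> R, forall y z, psi y + f y * (z - y) <= psi z.
Proof.
move=> ndf; pose I a b := \int[@lebesgue_measure R]_(x in `]a, b]) f x.
have intf a b := nondecreasing_integrable_itv R f a b ndf.
have I0 a b : b <= a -> I a b = 0.
  by move=> ba; rewrite /I set_itv_ge ?Rintegral_set0// bnd_simp -leNgt.
have ID a b c : a <= b -> b <= c -> I a c = I a b + I b c.
  move=> ab bc; rewrite /I -(@Rintegral_itvB _ f (BRight a) (BRight c) b)//.
  by rewrite addrC subrK.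
have Icst a b k : a <= b ->
    \int[@lebesgue_measure R]_(x in `]a, b]) (cst k x) = k * (b - a).
  move=> ab; rewrite Rintegral_cst//.
  rewrite [X in fine X](@lebesgue_measure_itv R `]a, b])/= lte_fin.
  case: ltP => //= ba; have -> : b = a by apply/eqP; rewrite eq_le ab ba.
  by rewrite subrr.
have ncst k : nondecreasing_fun (cst k : R -> R) by move=> ? ? _ /=.
have Ile a b : a <= b -> f a * (b - a) <= I a b /\ I a b <= f b * (b - a).
  move=> ab; rewrite -!Icst//; split; apply: le_Rintegral => //.
  - exact: (nondecreasing_integrable_itv R (cst (f a)) a b).
  - by move=> x /=; rewrite in_itv/= => /andP[/ltW /ndf].
  - exact: (nondecreasing_integrable_itv R (cst (f b)) a b).
  - by move=> x /=; rewrite in_itv/= => /andP[_ /ndf].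
(* Signed integral from 0 to [y]: one of the two intervals is always empty. *)
exists (fun y => I 0 y - I y 0) => y z.
have step a b : a <= b -> I 0 b - I b 0 = I 0 a - I a 0 + I a b.
  move=> ab; have [a0|a0] := leP 0 a.
    have b0 := le_trans a0 ab.
    by rewrite (I0 a 0)// (I0 b 0)// (ID 0 a b)// !subr0.
  have [b0|b0] := leP 0 b.
    by rewrite (I0 b 0)// (I0 0 a) ?(ltW a0)// (ID a 0 b) ?(ltW a0)//; lra.
  rewrite (I0 0 b) ?(ltW b0)// (I0 0 a) ?(ltW a0)//.
  by rewrite (ID a b 0) ?(ltW b0)//; lra.
have [yz|/ltW zy] := leP y z.
  by rewrite (step y z)//; have := Ile _ _ yz; lra.
by rewrite (step z y)//; have := Ile _ _ zy; lra.
Qed.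

(** Expanding the square turns the objective into [y^2/2 - y * x + conj x]. Fenchel's inequality
    bounds it below by [y^2/2 - psi y], with equality at the subgradient [x = f y]. *)
Lemma nondecreasing_argmin_prox (R : realType) (f : R -> R) :
  nondecreasing_fun f ->
  exists phi : R -> \bar R, proper_penalty phi /\
    forall y, argmin (fun x => ((2^-1 * (y - x) ^+ 2)%:E + phi x)%E) (f y).
Proof.
move=> /nondecreasing_subgradient[psi psiP].
(* [conj] is the Legendre transform of [psi], and [phi x = conj x - x^2 / 2]. *)
pose conj x := ereal_sup (range (fun y => (y * x - psi y)%:E)).
have conj_ge x y : ((y * x - psi y)%:E <= conj x)%E.
  by apply: ereal_sup_ubound; exists y.
have conj_f y : conj (f y) = (y * f y - psi y)%:E.
  apply/eqP; rewrite eq_le conj_ge andbT; apply: ge_ereal_sup => _ [z _ <-].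
  by rewrite lee_fin; have := psiP y z; lra.
exists (fun x => conj x - (2^-1 * x ^+ 2)%:E)%E; split.
  split=> [x|]; last by exists (f 0); rewrite conj_f.
  by have := conj_ge x 0; case: (conj x).
move=> y x; rewrite conj_f; have := conj_ge x y.
case: (conj x) => [r| |]//= cr; last by rewrite leey.
by move: cr; rewrite -!EFinB -!EFinD !lee_fin; lra.
Qed.

Lemma convex_functionTP (R : realType) (f : R -> R) :
  convex_function setT (f : R^o -> R^o) <->
  (forall a b t, 0 <= t <= 1 ->
     f (t * a + (1 - t) * b) <= t * f a + (1 - t) * f b).
Proof.
split=> [cf a b t /andP[t0 t1]|cf t a b _ _].
  by have := cf (Itv01 t0 t1) a b; rewrite !inE; exact.
by apply: cf; rewrite ge0 le1.
Qed.

(** * Tail decay of quasiconcave densities *)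

(** The rectangle of height [k] over [a, b] lies below the graph of [p]. *)
Lemma density_itv_le1 (R : realType) (p : R -> R) :
  (forall z, 0 < p z) -> continuous p ->
  (forall A : set R, measurable A ->
     (\int[lebesgue_measure]_(z in A) (p z)%:E <= 1)%E) ->
  forall a b k : R, a <= b -> 0 <= k ->
  (forall z, a <= z <= b -> k <= p z) -> k * (b - a) <= 1.
Proof.
move=> p_gt0 p_continuous p_mass a b k ab k0 kp; rewrite -lee_fin.
apply: le_trans (p_mass `[a, b]%classic _) => //.
have -> : (k * (b - a))%:E =
    (\int[lebesgue_measure]_(z in `[a, b]) (cst k%:E z))%E.
  rewrite integral_cst//=.
  rewrite [X in (_ * X)%E](@lebesgue_measure_itv R `[a, b])/= lte_fin.
  case: ltP => [_|ba]; first by rewrite -EFinB.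
  have -> : b = a by apply/eqP; rewrite eq_le ab ba.
  by rewrite subrr mulr0 mule0.
apply: ge0_le_integral => //=.
by apply/measurable_EFinP/measurable_funTS; exact: continuous_measurable_fun.
Qed.

Lemma quasiconcave_density_bound (R : realType) (p : R -> R) :
  (forall z, 0 < p z) -> continuous p ->
  (forall A : set R, measurable A ->
     (\int[lebesgue_measure]_(z in A) (p z)%:E <= 1)%E) ->
  (forall a b t, 0 <= t <= 1 ->
     Num.min (p a) (p b) <= p (t * a + (1 - t) * b)) ->
  exists B, forall z, (1 + `|z|) * p z <= B.
Proof.
move=> p_gt0 p_continuous p_mass qp.
(* The segment from 0 to [a] has length [`|a|], on it [p] is at least
   [min (p 0) (p a)], and [p] has mass at most 1. *)
have mass0 a : Num.min (p 0) (p a) * `|a| <= 1.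
  have [->|a_neq0] := eqVneq a 0; first by rewrite normr0 mulr0.
  have k0 : 0 <= Num.min (p 0) (p a) by rewrite le_min !ltW.
  have seg z : 0 <= z / a <= 1 -> Num.min (p 0) (p a) <= p z.
    move=> za; rewrite minC; have := qp a 0 _ za.
    by rewrite mulr0 addr0 divfK.
  have [a_ge0|a_lt0] := leP 0 a.
    have a_gt0 : 0 < a by rewrite lt_def a_neq0.
    rewrite (ger0_norm a_ge0) -[X in _ * X <= _]subr0.
    apply: (density_itv_le1 R p) => // z /andP[z0 za].
    by apply: seg; rewrite divr_ge0//= ler_pdivrMr// mul1r.
  rewrite (ltr0_norm a_lt0) -[X in _ * X <= _]add0r.
  apply: (density_itv_le1 R p) => //; first exact: ltW.
  move=> z /andP[az z0].
  by apply: seg; rewrite ler_ndivlMr// ler_ndivrMr// mul0r mul1r z0.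
(* Beyond [K], [p 0 * |z| > 1], so the minimum in [mass0] must be [p z]; as [1 <= K], also
   [p z <= |z| * p z <= 1] there, whence the 2 in the final bound. *)
pose K := (p 0)^-1 + 1.
have K1 : 1 <= K by rewrite lerDr invr_ge0 ltW.
have K0 : - K <= K by lra.
have [c _ pc] := EVT_max K0 (continuous_subspaceT p_continuous).
have in_bound z : `|z| <= K -> (1 + `|z|) * p z <= (1 + K) * p c.
  move=> zK; apply: ler_pM; [by rewrite addr_ge0|exact: ltW|by rewrite lerD2l|].
  by apply: pc; rewrite in_itv/= -ler_norml.
exists ((1 + K) * p c + 2) => z.
have pc0 := p_gt0 c.
have [/in_bound|zK] := leP `|z| K; first lra.
have : p z * `|z| <= 1.
  have := mass0 z; rewrite /Num.min; case: ifP => // _ p0z; exfalso.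
  have : `|z| <= (p 0)^-1 by rewrite -[leRHS]mul1r ler_pdivlMr// mulrC.
  by apply/negP; rewrite -ltNge; apply: lt_trans zK; rewrite /K ltrDl.
have pz0 := p_gt0 z; nra.
Qed.

(** * Expectations under a prior *)

Lemma bounded_integrable d (T : measurableType d) (R : realType)
    (P : probability T R) (g : T -> R) (B : R) :
  measurable_fun setT g -> (forall x, `|g x| <= B) ->
  P.-integrable setT (EFin \o g).
Proof.
move=> mg gB; apply: measurable_bounded_integrable => //.
  by rewrite [ltLHS]probability_setT ltry.
exists B; split; first exact: num_real.
by move=> M BM x _; exact: le_trans (gB x) (ltW BM).
Qed.

(** A zero integral would make [g] vanish almost everywhere, hence the whole space negligible. *)
Lemma Rintegral_gt0 d (T : measurableType d) (R : realType)
    (P : probability T R) (g : T -> R) :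
  (forall x, 0 < g x) -> P.-integrable setT (EFin \o g) ->
  0 < \int[P]_x g x.
Proof.
move=> g0 ig; rewrite lt_def Rintegral_ge0 ?andbT; last by move=> x _; exact: ltW.
apply/eqP => g_eq0.
have mg := measurable_int _ ig.
have : (\int[P]_x `|(EFin \o g) x| = 0)%E.
  under eq_integral do rewrite /= gtr0_norm//.
  rewrite -(fineK (integrable_fin_num _ ig))//.
  by rewrite -[fine _]/(\int[P]_x g x) g_eq0.
move=> /(ae_eq_integral_abs P measurableT mg)[N [mN PN0 sub]].
have : (P setT <= P N)%E.
  apply: le_measure; rewrite ?inE// => x _; apply: sub => /= /(_ I) [gx0].
  by have := g0 x; rewrite gx0 ltxx.
by rewrite PN0 probability_setT lee_fin ler10.
Qed.

(** The third hypothesis is the monotone likelihood ratio property, [q2 / q1] nondecreasing, in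
    cross-multiplied form. Both integrands are centred at the [q1]-mean [m]. *)
Lemma weighted_mean_le (R : realType) (P : probability (measurableTypeR R) R)
    (q1 q2 : R -> R) :
  (forall x, 0 < q1 x) -> (forall x, 0 < q2 x) ->
  (forall x z, z <= x -> q1 x * q2 z <= q1 z * q2 x) ->
  P.-integrable setT (EFin \o q1) -> P.-integrable setT (EFin \o q2) ->
  P.-integrable setT (EFin \o (fun x => x * q1 x)) ->
  P.-integrable setT (EFin \o (fun x => x * q2 x)) ->
  (\int[P]_x (x * q1 x)) / (\int[P]_x q1 x) <=
  (\int[P]_x (x * q2 x)) / (\int[P]_x q2 x).
Proof.
move=> q1_gt0 q2_gt0 mlr i1 i2 ix1 ix2.
have D1 := Rintegral_gt0 _ _ _ P q1 q1_gt0 i1.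
have D2 := Rintegral_gt0 _ _ _ P q2 q2_gt0 i2.
set m := _ / _.
have centered q k : P.-integrable setT (EFin \o q) ->
    P.-integrable setT (EFin \o (fun x => x * q x)) ->
    P.-integrable setT (EFin \o (fun x => k * (x * q x - m * q x))) /\
    \int[P]_x (k * (x * q x - m * q x)) =
    k * ((\int[P]_x (x * q x)) - m * (\int[P]_x q x)).
  move=> iq ixq.
  have imq : P.-integrable setT (EFin \o (fun x => m * q x)).
    exact: (@integrableZl _ _ _ P _ measurableT m _ iq).
  have idq : P.-integrable setT (EFin \o (fun x => x * q x - m * q x)).
    exact: (@integrableB _ _ _ P _ measurableT _ _ ixq imq).
  split; first exact: (@integrableZl _ _ _ P _ measurableT k _ idq).
  by rewrite RintegralZl// RintegralB// RintegralZl.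
pose c := q2 m / q1 m.
have [ic1 Ec1] := centered q1 c i1 ix1.
have [ic2 Ec2] := centered q2 1 i2 ix2.
(* [q2 x - c * q1 x] has the sign of [x - m], the ratio [q2 / q1] being
   nondecreasing with value [c] at [m]. *)
have : \int[P]_x (c * (x * q1 x - m * q1 x)) <=
       \int[P]_x (1 * (x * q2 x - m * q2 x)).
  apply: le_Rintegral => // x _.
  rewrite mul1r -!mulrBl mulrCA -subr_ge0 -mulrBr.
  have cE : c * q1 x = q1 x * q2 m / q1 m by rewrite /c mulrC mulrA.
  have [mx|/ltW xm] := leP m x.
    apply: mulr_ge0; first by rewrite subr_ge0.
    by rewrite subr_ge0 cE ler_pdivrMr// [leRHS]mulrC mlr.
  apply: mulr_le0; first by rewrite subr_le0.
  by rewrite subr_le0 cE ler_pdivlMr// mulrC mlr.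
(* The left integral vanishes by the choice of [m]. *)
rewrite Ec1 Ec2 mul1r {1}/m divfK ?gt_eqF// subrr mulr0 subr_ge0.
by rewrite ler_pdivlMr.
Qed.

(** This is [(delta_0 + delta_h)/2], built as the image of a fair coin. *)
Lemma two_point_prior (R : realType) (h : R) :
  exists P : probability (measurableTypeR R) R, forall g : R -> R,
    measurable_fun setT g -> 0 <= g 0 -> 0 <= g h ->
    'E_P[g]%E = (2^-1 * (g h + g 0))%:E.
Proof.
have half01 : 0 <= (2^-1 : R) <= 1 by lra.
pose X0 (b : bool) : measurableTypeR R := if b then h else 0.
have mX : measurable_fun setT X0 by [].
pose X : {mfun bool >-> measurableTypeR R} := mfun_Sub (mem_set mX).
exists (distribution (bernoulli_prob (2^-1 : R)) X) => g mg g0 gh.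
have gX_ge0 b : (0 <= (EFin \o g \o X) b)%E by case: b; rewrite /= lee_fin.
have gX_int : (\int[bernoulli_prob (2^-1 : R)]_b (EFin \o g \o X) b =
               (2^-1 * (g h + g 0))%:E)%E.
  rewrite integral_bernoulli_prob//= -!EFinM -EFinD; congr EFin.
  rewrite /unstable.onem; lra.
rewrite unlock integral_distribution//; first exact/measurable_EFinP.
apply/integrableP; split => //.
by under eq_integral do rewrite gee0_abs//; rewrite gX_int ltry.
Qed.

(** * Product and minimum inequalities for log-concave densities *)

Lemma log_concave_mul (R : realType) (p : R -> R) :
  (forall z, 0 < p z) ->
  (forall a b t, 0 <= t <= 1 ->
     - ln (p (t * a + (1 - t) * b)) <= t * - ln (p a) + (1 - t) * - ln (p b)) ->
  forall a b s, 0 <= s <= b - a -> p a * p b <= p (a + s) * p (b - s).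
Proof.
move=> p0 cF a b s sab.
have := convex_shift_in R (fun z => - ln (p z)) cF a b s sab.
rewrite -!opprD lerN2 -!lnM ?posrE//.
by rewrite ler_ln ?posrE ?mulr_gt0.
Qed.

(** The logarithm of the minimum is below both logarithms, hence below their weighted mean. *)
Lemma log_concave_quasiconcave (R : realType) (p : R -> R) :
  (forall z, 0 < p z) ->
  (forall a b t, 0 <= t <= 1 ->
     - ln (p (t * a + (1 - t) * b)) <= t * - ln (p a) + (1 - t) * - ln (p b)) ->
  forall a b t, 0 <= t <= 1 -> Num.min (p a) (p b) <= p (t * a + (1 - t) * b).
Proof.
move=> p0 cF a b t t01; have := cF a b t t01.
have m0 : 0 < Num.min (p a) (p b) by rewrite lt_min !p0.
rewrite -ler_ln ?posrE//.
have : ln (Num.min (p a) (p b)) <= ln (p a).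
  by rewrite ler_ln ?posrE// ge_min lexx.
have : ln (Num.min (p a) (p b)) <= ln (p b).
  by rewrite ler_ln ?posrE// ge_min lexx orbT.
case/andP: t01; nra.
Qed.

(** * Monotone posterior means and log-concave noise *)

Theorem proposition2 (R : realType) (d : measure_display)
    (Omega : measurableType d) (P : probability Omega R) (Z : {RV P >-> R})
    (pZ : R -> R) (pZ_density : density_of Z pZ)
    (pZ_gt0 : forall z, 0 < pZ z)
    (F := fun z : R => - ln (pZ z))
    (F_continuous : continuous F) :
  convex_function setT (F : R^o -> R^o)
  <->
  (forall pX : probability (measurableTypeR R) R,
     (forall y : R, cond_expectation_well_defined pZ pX y) /\
     (exists phi : R -> \bar R,
        proper_penalty phi /\
        forall y : R,
          argmin (fun x : R => ((2^-1 * (y - x) ^+ 2)%:E + phi x)%E)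
                 (cond_expectation pZ pX y))).
Proof.
have pZE z : pZ z = expR (- F z) by rewrite /F opprK lnK// posrE.
have p_cont : continuous pZ.
  have -> : pZ = expR \o (fun z => - F z) by apply/funext => z; rewrite pZE.
  move=> z; apply: continuous_comp; [exact/continuousN/F_continuous|].
  exact: continuous_expR.
have p_shift_measurable y : measurable_fun setT (density_Y_given_X pZ y).
  apply: continuous_measurable_fun => x.
  apply: continuous_comp; last exact: p_cont.
  by apply: cvgB; [exact: cvg_cst|exact: cvg_id].
split.
  move=> /convex_functionTP cF.
  have p_mass A : measurable A ->
      (\int[lebesgue_measure]_(z in A) (pZ z)%:E <= 1)%E.
    by case: pZ_density => _ _ pA mA; rewrite -pA// probability_le1.
  have [B pB] := quasiconcave_density_bound R pZ pZ_gt0 p_cont p_mass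
    (log_concave_quasiconcave R pZ pZ_gt0 cF).
  (* The tail bound is moved from [y - x] to [x] by [1 + |x| <= (1 + |y|) * (1 + |y - x|)]; it is
     uniform in [x], hence serves every prior. *)
  have bound y x : (1 + `|x|) * pZ (y - x) <= (1 + `|y|) * B.
    apply: (@le_trans _ _ ((1 + `|y|) * ((1 + `|y - x|) * pZ (y - x)))); last first.
      by rewrite ler_wpM2l ?addr_ge0.
    rewrite mulrA ler_wpM2r ?(ltW (pZ_gt0 _))//.
    have xy : `|x| <= `|y| + `|y - x|.
      by rewrite -[X in `|X| <= _](subKr y); exact: ler_normB.
    by have := mulr_ge0 (normr_ge0 y) (normr_ge0 (y - x)); lra.
  move=> pX.
  have int_bounded (g : R -> R) y : measurable_fun setT g ->
      (forall x, `|g x| <= (1 + `|x|) * pZ (y - x)) ->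
      pX.-integrable setT (EFin \o g).
    move=> mg gB; apply: (bounded_integrable _ _ _ _ _ ((1 + `|y|) * B)) => // x.
    exact: le_trans (gB x) (bound y x).
  have int_all y : pX.-integrable setT
      (EFin \o (fun x => (1 + `|x|) * density_Y_given_X pZ y x)).
    apply: (int_bounded _ y).
      by apply: measurable_funM => //; exact: measurable_funD.
    by move=> x; rewrite ger0_norm//;
      exact: (mulr_ge0 (addr_ge0 ler01 (normr_ge0 _)) (ltW (pZ_gt0 _))).
  have int_p y : pX.-integrable setT (EFin \o density_Y_given_X pZ y).
    apply: (int_bounded _ y) => // x; rewrite /density_Y_given_X gtr0_norm//.
    by rewrite ler_peMl ?(ltW (pZ_gt0 _))// lerDl.
  have int_xp y : pX.-integrable setT
      (EFin \o (fun x => x * density_Y_given_X pZ y x)).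
    apply: (int_bounded _ y) => [|x]; first exact: measurable_funM.
    rewrite /density_Y_given_X normrM (gtr0_norm (pZ_gt0 _)).
    by rewrite ler_wpM2r ?(ltW (pZ_gt0 _))// lerDr.
  split=> [y|].
    rewrite /cond_expectation_well_defined unlock ltey_eq.
    by rewrite (integrable_fin_num measurableT (int_all y)).
  apply: nondecreasing_argmin_prox => y z yz.
  rewrite /cond_expectation unlock.
  apply: weighted_mean_le => //; [by move=> x; exact: pZ_gt0..|move=> x w wx].
  rewrite /density_Y_given_X mulrC.
  (* The outer points [y - x] and [z - w] move inward by [x - w], to [y - w] and [z - x]. *)
  have := log_concave_mul R pZ pZ_gt0 cF (y - x) (z - w) (x - w).
  rewrite (_ : y - x + (x - w) = y - w); last by ring.
  rewrite (_ : z - w - (x - w) = z - x); last by ring.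
  rewrite mulrC; apply; apply/andP; split; lra.
move=> prox; apply/convex_functionTP.
apply: midpoint_convex_continuous => //.
have mid x h : 0 < h -> pZ (x - h) * pZ (x + h) <= pZ x * pZ x.
  move=> h0; have [pX EX] := two_point_prior R h.
  have [_ [phi [phi_proper phi_min]]] := prox pX.
  (* The mean is [h] times the posterior weight of the atom [h]; the factors 1/2 cancel. *)
  have condE y :
      cond_expectation pZ pX y = h * pZ (y - h) / (pZ (y - h) + pZ y).
    have Ep := EX (density_Y_given_X pZ y) (p_shift_measurable y)
      (ltW (pZ_gt0 _)) (ltW (pZ_gt0 _)).
    have Exp : 'E_pX[fun x => (x * density_Y_given_X pZ y x)%R]%E =
               (2^-1 * (h * density_Y_given_X pZ y h))%:E.
      rewrite EX ?mul0r ?addr0//; first exact: measurable_funM.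
      exact: (mulr_ge0 (ltW h0) (ltW (pZ_gt0 _))).
    rewrite /cond_expectation Exp Ep /= /density_Y_given_X subr0.
    by rewrite -mulf_div divff ?mul1r.
  (* After cross-multiplication, the term [pZ (x - h) * pZ x] appears on both sides and cancels. *)
  have := argmin_prox_nondecreasing R phi _ phi_proper phi_min x (x + h).
  rewrite !condE addrK lerDl => /(_ (ltW h0)).
  rewrite ler_pdivrMr ?addr_gt0// mulrAC ler_pdivlMr ?addr_gt0//.
  rewrite -!mulrA ler_pM2l// !mulrDr; lra.
have Fmid x h : 0 < h -> F x *+ 2 <= F (x - h) + F (x + h).
  move=> /(mid x); rewrite -ler_ln ?posrE ?mulr_gt0// !lnM ?posrE//.
  rewrite /F mulr2n; lra.
(* The inequality is symmetric in [h], and an equality at 0. *)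
move=> x h; have [h0|h0|<-] := ltgtP 0 h; first exact: Fmid.
  by have := Fmid x (- h); rewrite opprK oppr_gt0 addrC => ->.
by rewrite subr0 addr0 mulr2n.
Qed.
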